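(* Let $\boldsymbol{\nu}_1,\ldots,\boldsymbol{\nu}_n$ be $m$-tuples of umbral monomials and, for $\boldsymbol{i}\in\mathbb{N}_0^m$, let $B_{\boldsymbol{i}}(x_1,\ldots,x_n)\in R[x_1,\dots,x_n]$ denote the associated generalized Bell polynomial. Then $$B_{\boldsymbol{i}}(x_1,\ldots,x_n)\simeq(x_1\boldsymbol{.}\beta\boldsymbol{.}\boldsymbol{\nu}_1+\cdots+x_n\boldsymbol{.}\beta\boldsymbol{.}\boldsymbol{\nu}_n)^{\boldsymbol{i}},$$ that is, $B_{\boldsymbol{i}}(x_1,\dots,x_n)=E[(x_1\boldsymbol{.}\beta\boldsymbol{.}\boldsymbol{\nu}_1+\cdots+x_n\boldsymbol{.}\beta\boldsymbol{.}\boldsymbol{\nu}_n)^{\boldsymbol{i}}]$ in $R[x_1,\dots,x_n]$.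
   Context: $R$ is the real or complex field, $A$ is a set (the alphabet) whose elements are called umbrae, and $E$ is a linear evaluation, here on $R[x_1,\dots,x_n][A]$ with values in $R[x_1,\dots,x_n]$ and $R[x_1,\dots,x_n]$-linear, with $E[1]=1$ and $E[\alpha^i\gamma^j\cdots]=E[\alpha^i]E[\gamma^j]\cdots$ for distinct umbrae and nonnegative integers $i,j,\dots$ (the moments of umbrae being in $R$). Umbral equivalence $p\simeq q$ means $E[p]=E[q]$. An $m$-tuple $\boldsymbol{\nu}$ of umbral monomials (monomials in $R[A]$) has moments $E[\boldsymbol{\nu}^{\boldsymbol{k}}]$, $\boldsymbol{\nu}^{\boldsymbol{k}}=\nu_1^{k_1}\cdots\nu_m^{k_m}$, $\boldsymbol{k}\in\mathbb{N}_0^m$, and generating function $f(\boldsymbol{\nu},\boldsymbol{t}_{(m)})=1+\sum_{\boldsymbol{k}\ne\boldsymbol{0}}E[\boldsymbol{\nu}^{\boldsymbol{k}}]\boldsymbol{t}_{(m)}^{\boldsymbol{k}}/\boldsymbol{k}!$, where $\boldsymbol{t}_{(m)}=(t_1,\dots,t_m)$, $\boldsymbol{k}!=k_1!\cdots k_m!$. Generalized Bell polynomial: $B_{\boldsymbol{i}}(x_1,\dots,x_n)$ is the $\boldsymbol{i}$-th coefficient, i.e. the coefficient of $\boldsymbol{t}_{(m)}^{\boldsymbol{i}}/\boldsymbol{i}!$, of $\exp\{\sum_{j=1}^n x_j[f(\boldsymbol{\nu}_j,\boldsymbol{t}_{(m)})-1]\}$. Partitions of a multi-index: a partition $\boldsymbol{\lambda}$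 of $\boldsymbol{k}\in\mathbb{N}_0^m$, written $\boldsymbol{\lambda}\vdash\boldsymbol{k}$, is a matrix of nonnegative integers with $m$ rows, no zero column, columns in lexicographic order, and $r$-th row sum equal to $k_r$ (for $\boldsymbol{k}=\boldsymbol{0}$ only the empty one). Its number of columns is $l(\boldsymbol{\lambda})$. Writing $\boldsymbol{\lambda}=(\boldsymbol{\lambda}_1^{r_1},\boldsymbol{\lambda}_2^{r_2},\dots)$ when the distinct column $\boldsymbol{\lambda}_s$ occurs $r_s$ times, set $\mathfrak{m}(\boldsymbol{\lambda})!=r_1!r_2!\cdots$ and $\boldsymbol{\lambda}!=\prod_s(\boldsymbol{\lambda}_s!)^{r_s}$. The auxiliary umbra $x_j\boldsymbol{.}\beta\boldsymbol{.}\boldsymbol{\nu}_j$ ($\beta$ denotes the Bell umbra) is the symbolic $m$-tuple with moments $$E[(x_j\boldsymbol{.}\beta\boldsymbol{.}\boldsymbol{\nu}_j)^{\boldsymbol{k}}]=\sum_{\boldsymbol{\lambda}\vdash\boldsymbol{k}}\frac{\boldsymbol{k}!}{\mathfrak{m}(\boldsymbol{\lambda})!\,\boldsymbol{\lambda}!}\,x_j^{l(\boldsymbol{\lambda})}\prod_s\big(E[\boldsymbol{\nu}_j^{\boldsymbol{\lambda}_s}]\big)^{r_s}.$$ In the (componentwise) sum $x_1\boldsymbol{.}\beta\boldsymbol{.}\boldsymbol{\nu}_1+\cdots+x_n\boldsymbol{.}\beta\boldsymbol{.}\boldsymbol{\nu}_n$ the summands are mutually uncorrelated, so that its $\boldsymbol{i}$-th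 moment is $\sum_{\boldsymbol{k}_1+\cdots+\boldsymbol{k}_n=\boldsymbol{i}}\frac{\boldsymbol{i}!}{\boldsymbol{k}_1!\cdots\boldsymbol{k}_n!}\prod_{j=1}^nE[(x_j\boldsymbol{.}\beta\boldsymbol{.}\boldsymbol{\nu}_j)^{\boldsymbol{k}_j}]$. *)

(* Defs.v *)
From HB Require Import structures.
From mathcomp Require Import all_boot all_order all_algebra finmap.
From mathcomp Require Export monalg.
From mathcomp Require Export mpoly.

Set Implicit Arguments.
Unset Strict Implicit.
Unset Printing Implicit Defensive.

Import Order.TTheory GRing.Theory Num.Theory.
Local Open Scope ring_scope.

Definition mfact m (k : 'X_{1..m}) : nat := (\prod_(r < m) (k r)`!)%N.

(* Formal power series in m variables, given by their coefficients: f k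
   is the coefficient of t^k, so that the "k-th coefficient" in the sense of
   exponential generating functions is k! * f k. *)
Section FormalPowerSeries.
Variables (R : numFieldType) (m : nat) (C : algType R).

Definition fps := 'X_{1..m} -> C.

Definition fps_one : fps := fun k => (k == 0%MM)%:R.

Definition fps_mul (f g : fps) : fps := fun k =>
  \sum_(ab : 'X_{1..m < (mdeg k).+1, (mdeg k).+1} | k == (ab.1 + ab.2)%MM)
     f ab.1 * g ab.2.

Definition fps_pow (g : fps) (p : nat) : fps := iter p (fps_mul g) fps_one.

(* exp g = sum_p g^p / p!, for g without constant term: then g^p has no term of
   degree < p (fps_pow_eq0), and the sum giving the coefficient at k is the
   finite sum over p <= |k|. *)
Definition fps_exp (g : fps) : fps := fun k =>
  \sum_(p < (mdeg k).+1) (p`!%:R : R)^-1 *: fps_pow g p k.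

Lemma fps_pow_eq0 (g : fps) (p : nat) (k : 'X_{1..m}) :
  g 0%MM = 0 -> (mdeg k < p)%N -> fps_pow g p k = 0.
Proof.
move=> g0; elim: p k => [//|p IHp] k /= lt_k; rewrite /fps_mul big1 // => ab.
move=> /eqP kE; have [-> | nz] := eqVneq (bmnm ab.1) 0%MM.
  by rewrite g0 mul0r.
rewrite [X in _ * X]IHp ?mulr0 //.
have degE : mdeg k = (mdeg ab.1 + mdeg ab.2)%N by rewrite -mdegD -kE.
have := lt_k; rewrite [X in (X < _)%N]degE ltnS; apply: leq_trans.
by rewrite -[X in (X < _)%N]add0n ltn_add2r lt0n mdeg_eq0.
Qed.

End FormalPowerSeries.

(* Partitions of a multi-index k: the matrix is given by the sequence of
   its columns. *)
Section MultiPartitions.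
Variable m : nat.
Implicit Types (k c : 'X_{1..m}) (s : seq 'X_{1..m}).

(* The plain lexicographic order; the canonical order of 'X_{1..m} compares
   total degrees first. *)
Definition mlex : rel 'X_{1..m} :=
  fun c d => (tval (multinom_val c) <= tval (multinom_val d) :> seqlexi nat)%O.

Definition is_mpart k s : bool :=
  [&& sorted mlex s, 0%MM \notin s
    & [forall r : 'I_m, (\sum_(c <- s) c r)%N == k r]].

Definition mpart_mult s : nat := (\prod_(c <- undup s) (count_mem c s)`!)%N.

Definition mpart_fact s : nat :=
  (\prod_(c <- undup s) mfact c ^ count_mem c s)%N.

(* A partition of k has at most |k| columns, each of total degree at most |k|
   (mpart_bound), so this finite sum runs over all partitions of k. *)
Definition sum_mpart (V : nmodType) k (F : seq 'X_{1..m} -> V) : V :=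
  \sum_(l < (mdeg k).+1)
    \sum_(t : l.-tuple 'X_{1..m < (mdeg k).+1} | is_mpart k (map val t))
      F (map val t).

Lemma mpart_bound k s : is_mpart k s ->
  (size s <= mdeg k)%N /\ (forall c, c \in s -> (mdeg c <= mdeg k)%N).
Proof.
case/and3P=> _ nz /forallP ks.
have kE : mdeg k = (\sum_(c <- s) mdeg c)%N.
  rewrite mdegE (eq_bigr (fun r => \sum_(c <- s) c r)%N) => [|r _].
    by rewrite exchange_big /=; apply: eq_bigr => c _; rewrite mdegE.
  by rewrite (eqP (ks r)).
split=> [|c cs]; last by rewrite kE (big_rem c cs) leq_addr.
rewrite kE -sum1_size big_seq [leqRHS]big_seq; apply: leq_sum => c cs.
by rewrite lt0n mdeg_eq0; apply: contraNneq nz => <-.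
Qed.

End MultiPartitions.

Definition umbral_equiv (V W : Type) (E : V -> W) (p q : V) : Prop := E p = E q.

Section Umbral.
Variables (R : numFieldType) (n m : nat) (A : choiceType).

Local Notation Rx := {mpoly R[n]}.

(* R[x_1, ..., x_n][S], for an arbitrary set S of symbols. *)
Definition upoly (S : choiceType) := {malg Rx[{cmonom S}]}.

Definition umbra (S : choiceType) (a : S) : upoly S := mkmalgU (ucm a) 1.

Implicit Type E : {scalar upoly A}.

Record umbral_evaluation E : Prop := UmbralEvaluation {
  umbral_eval1 : E 1 = 1;
  umbral_uncorrelated : forall (s : seq A) (k : A -> nat), uniq s ->
    E (\prod_(a <- s) umbra a ^+ k a) = \prod_(a <- s) E (umbra a ^+ k a);
  umbral_moment : forall (a : A) (k : nat),
    exists c : R, E (umbra a ^+ k) = mpolyC n c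
}.

(* A scalar coefficient is allowed in umbral monomials. *)
Definition umbral_monomial (p : upoly A) : Prop :=
  exists (c : R) (u : {cmonom A}), p = mkmalgU u (mpolyC n c).

Definition tuple_pow (C : pzSemiRingType) (nu : m.-tuple C) (k : 'X_{1..m}) : C :=
  \prod_(r < m) tnth nu r ^+ k r.

Definition genfun E (nu : m.-tuple (upoly A)) : fps m Rx := fun k =>
  if k == 0%MM then 1 else ((mfact k)%:R : R)^-1 *: E (tuple_pow nu k).

Definition bell_poly E (nu : 'I_n -> m.-tuple (upoly A)) (i : 'X_{1..m}) : Rx :=
  (mfact i)%:R *
    fps_exp (fun k => \sum_(j < n) 'X_j * (genfun E (nu j) k - fps_one Rx k)) i.

(* The k-th moment of x_j.beta.nu. *)
Definition aux_moment E (j : 'I_n) (nu : m.-tuple (upoly A)) (k : 'X_{1..m}) : Rx :=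
  sum_mpart k (fun s =>
    ((mfact k)%:R / (mpart_mult s * mpart_fact s)%:R : R) *:
      ('X_j ^+ size s *
       \prod_(c <- undup s) E (tuple_pow nu c) ^+ count_mem c s)).

(* The alphabet enlarged with one symbol for each component r of each
   auxiliary tuple x_j.beta.nu_j.  The evaluation is extended to it so that the
   auxiliary tuples have the above moments and are uncorrelated with each other
   and with the umbrae of A (the components of a single auxiliary tuple are in
   general correlated). *)
Definition aux_alphabet : choiceType := (A + 'I_n * 'I_m)%type.

Definition aux_eval_monom E (nu : 'I_n -> m.-tuple (upoly A))
    (u : {cmonom aux_alphabet}) : Rx :=
  (\prod_(s <- finsupp u)
      if s is inl a then E (umbra a ^+ u (inl a)) else 1) *
  \prod_(j < n) aux_moment E j (nu j) [multinom u (inr (j, r)) | r < m].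

Definition aux_eval E (nu : 'I_n -> m.-tuple (upoly A)) :
    upoly aux_alphabet -> Rx :=
  monalg.mmap idfun (aux_eval_monom E nu).

Lemma aux_eval_is_linear E nu : linear_for *%R (aux_eval E nu).
Proof.
move=> c p q; rewrite /aux_eval monalg.mmapD; congr (_ + _).
rewrite (monalg.mmapEw (monalg.msuppZ_le _ _)) monalg.mmapE big_distrr /=.
by apply/eq_bigr => u _; rewrite monalg.mcoeffZ -mulrA.
Qed.

HB.instance Definition _ E nu :=
  GRing.isLinear.Build Rx (upoly aux_alphabet) Rx *%R (aux_eval E nu)
    (aux_eval_is_linear E nu).

Definition aux_tuple (j : 'I_n) : m.-tuple (upoly aux_alphabet) :=
  [tuple umbra (inr (j, r) : aux_alphabet) | r < m].

(* x_1.beta.nu_1 + ... + x_n.beta.nu_n *)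
Definition aux_sum : m.-tuple (upoly aux_alphabet) :=
  [tuple \sum_(j < n) tnth (aux_tuple j) r | r < m].

Lemma aux_moment0 E j nu : aux_moment E j nu 0%MM = 1.
Proof.
rewrite /aux_moment /sum_mpart mdeg0 big_ord1 /= (bigD1 [tuple]) /=; last first.
  by apply/and3P; split=> //; apply/forallP => r; rewrite big_nil mnm0E.
rewrite [X in _ + X]big1 => [|t /andP[_ /eqP[]]]; last exact: tuple0.
rewrite /mpart_mult /mpart_fact /= !big_nil expr0 mulr1 addr0.
by rewrite /mfact big1 ?divff ?scale1r ?oner_neq0 // => r _; rewrite mnm0E.
Qed.

Lemma upolyUM (S : choiceType) (u v : {cmonom S}) :
  (mkmalgU u 1 : upoly S) * mkmalgU v 1 = mkmalgU (mmul u v) 1.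
Proof.
by rewrite (malgM_def (mkmalgU u 1) (mkmalgU v 1)) fgmulUU (mulr1 (1 : Rx)).
Qed.

Lemma umbra_powE (S : choiceType) (a : S) k :
  umbra a ^+ k = mkmalgU (iter k (mmul (ucm a)) mone) 1.
Proof.
elim: k => [|k IHk]; first exact: expr0.
rewrite exprS IHk; exact: upolyUM.
Qed.

(* All the moments of the enlarged alphabet. *)
Lemma aux_evalE E nu (s : seq A) (k : A -> nat) (kk : 'I_n -> 'X_{1..m}) :
  umbral_evaluation E -> uniq s ->
  aux_eval E nu (\prod_(a <- s) umbra (inl a : aux_alphabet) ^+ k a
                 * \prod_(j < n) tuple_pow (aux_tuple j) (kk j))
  = E (\prod_(a <- s) umbra a ^+ k a)
    * \prod_(j < n) aux_moment E j (nu j) (kk j).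
Proof.
move=> hE us.
pose mon (a : aux_alphabet) (p : nat) : {cmonom aux_alphabet} := iter p (mmul (ucm a)) mone.
have monE a p b : mon a p b = (p * (a == b))%N.
  elim: p => [|p IHp]; first by rewrite /mon /= cm1.
  by rewrite /mon iterS cmM -/(mon a p) IHp cmU mulSn.
have prodE (I : Type) (r : seq I) (F : I -> upoly aux_alphabet) (G : I -> {cmonom aux_alphabet}) :
    (forall x, F x = mkmalgU (G x) 1) ->
    \prod_(x <- r) F x = mkmalgU (\big[mmul/mone]_(x <- r) G x) 1.
  move=> FG; elim: r => [|x r IHr]; first (rewrite !big_nil; reflexivity).
  rewrite !big_cons IHr FG; exact: upolyUM.
have bigE (I : Type) (r : seq I) (G : I -> {cmonom aux_alphabet}) b :
    (\big[mmul/mone]_(x <- r) G x) b = (\sum_(x <- r) G x b)%N.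
  by elim: r => [|x r IHr]; rewrite ?big_nil ?cm1 // !big_cons cmM IHr.
pose U1 := \big[mmul/mone]_(a <- s) mon (inl a) (k a).
pose U2 := \big[mmul/mone]_(j < n) \big[mmul/mone]_(r < m) mon (inr (j, r)) (kk j r).
have -> : \prod_(a <- s) umbra (inl a : aux_alphabet) ^+ k a
          * \prod_(j < n) tuple_pow (aux_tuple j) (kk j) = mkmalgU (mmul U1 U2) 1.
  rewrite (prodE _ _ _ (fun a => mon (inl a) (k a))); last first.
    move=> a; exact: umbra_powE.
  rewrite (prodE _ _ _ (fun j => \big[mmul/mone]_(r < m) mon (inr (j, r)) (kk j r))).
    exact: upolyUM.
  move=> j; rewrite /tuple_pow (prodE _ _ _ (fun r => mon (inr (j, r)) (kk j r))) //.
  move=> r; rewrite tnth_mktuple; exact: umbra_powE.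
rewrite /aux_eval monalg.mmapU mul1r /aux_eval_monom.
have U2l a : U2 (inl a) = 0%N.
  by rewrite bigE big1 // => j _; rewrite bigE big1 // => r _; rewrite monE muln0.
have U1r x : U1 (inr x) = 0%N by rewrite bigE big1 // => a _; rewrite monE muln0.
have U1l a : U1 (inl a) = if a \in s then k a else 0%N.
  rewrite bigE; case: ifP => as_.
    rewrite (bigD1_seq a) //= monE eqxx muln1 big1 ?addn0 // => b ba.
    rewrite monE; case: eqP => [[ba']|_]; rewrite ?muln0 //.
    by rewrite ba' eqxx in ba.
  rewrite big_seq big1 // => b bs; rewrite monE; case: eqP => [[ba]|_]; rewrite ?muln0 //.
  by rewrite -ba bs in as_.
have U2r j r : U2 (inr (j, r)) = kk j r.
  rewrite bigE (bigD1 j isT) /= [X in (_ + X)%N]big1 => [|j' nj]; last first.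
    rewrite bigE big1 // => r' _; rewrite monE.
    by case: eqP => [[jj _]|_]; rewrite ?muln0 // jj eqxx in nj *.
  rewrite addn0 bigE (bigD1 r isT) /= monE eqxx muln1.
  rewrite [X in (_ + X)%N]big1 ?addn0 // => r' nr; rewrite monE.
  by case: eqP => [[rr]|_]; rewrite ?muln0 // rr eqxx in nr *.
congr (_ * _); last first.
  apply: eq_bigr => j _; congr aux_moment; apply/mnmP => r.
  by rewrite mnmE cmM U1r U2r.
rewrite umbral_uncorrelated //.
pose F (x : aux_alphabet) : Rx := if x is inl a then E (umbra a ^+ mmul U1 U2 (inl a)) else 1.
rewrite (eq_bigr F) //.
have F1 x : mmul U1 U2 x = 0%N -> F x = 1.
  by case: x => //= a ->; rewrite expr0 umbral_eval1.
have -> : \prod_(a <- s) E (umbra a ^+ k a) = \prod_(x <- [seq inl a : aux_alphabet | a <- s]) F x.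
  rewrite big_map big_seq [RHS]big_seq; apply: eq_bigr => a as_.
  by rewrite /F cmM U1l U2l as_ addn0.
rewrite [RHS](bigID (fun x => x \in finsupp (mmul U1 U2))) /=.
rewrite [X in _ = _ * X]big1 => [|x xn]; last by apply: F1; apply/eqP; rewrite cmE_eq0.
rewrite mulr1 (bigID (fun x => x \in [seq inl a : aux_alphabet | a <- s])) /=.
rewrite [X in _ * X]big1 => [|x xs]; last first.
  case: x xs => //= a; rewrite mem_map; last by move=> b c [].
  by move=> /negbTE as_; rewrite cmM U1l U2l as_ expr0 umbral_eval1.
rewrite mulr1 -big_filter -[RHS]big_filter; apply: perm_big; apply: uniq_perm.
- by apply: filter_uniq; exact: fset_uniq.
- by rewrite filter_uniq // map_inj_uniq // => a b [].
by move=> x; rewrite !mem_filter andbC.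
Qed.

End Umbral.

(* Main.v *)
(** Substituting finitely many monomials z_i t^{w_i} in the exponential and
    using exp(P + Q) = exp(P) exp(Q) gives
    exp(sum_i z_i t^{w_i}) = prod_i sum_r (z_i^r / r!) t^{r w_i},
    whose coefficient at t^k is a sum over multiplicity functions r with
    sum_i r_i w_i = k.  With the w_i running over all monomials, these functions
    are the partitions of k, so k! times the coefficient of
    exp(x_j (f(nu_j, t) - 1)) at t^k is the k-th moment of x_j.beta.nu_j.  The
    product over j of these exponentials yields the convolution of moments, and
    the same identity applied to
    exp(sum_r (sum_j y_{jr}) t_r) = prod_j exp(sum_r y_{jr} t_r) yields the
    multinomial expansion of the power of the sum of tuples.  Power series are
    replaced by polynomials compared up to a given total degree. *)

Require Import Defs.
From mathcomp Require Import all_boot all_order all_algebra.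

Set Implicit Arguments.
Unset Strict Implicit.
Unset Printing Implicit Defensive.

Import Order.TTheory GRing.Theory Num.Theory.
Local Open Scope ring_scope.

(** * Polynomials compared up to a total degree *)

Section TruncatedPolynomials.
(* [mpoly m C] is written out below because in type scope [{mpoly C[m]}] denotes
   the monoid algebra of monalg. *)
Variables (m : nat) (C : comNzRingType).
Implicit Types P Q : mpoly m C.

Definition eq_upto D P Q := forall k, (mdeg k <= D)%N -> P@_k = Q@_k.

Definition order_ge d P := forall k, (mdeg k < d)%N -> P@_k = 0.

Definition truncation D (f : 'X_{1..m} -> C) : mpoly m C :=
  \sum_(k : 'X_{1..m < D.+1}) f k *: 'X_[k].

Lemma mcoeff_truncation D f k : (mdeg k <= D)%N -> (truncation D f)@_k = f k.
Proof. by move=> ?; rewrite mcoeff_mpoly. Qed.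

(** Exponents that add up to degree at most [D] each have degree at most [D]. *)
Lemma eq_uptoM D P P' Q Q' :
  eq_upto D P P' -> eq_upto D Q Q' -> eq_upto D (P * Q) (P' * Q').
Proof.
move=> eP eQ k kD; rewrite !mcoeffM; apply: eq_bigr => -[a b] /= /eqP kE.
have abD : (mdeg a + mdeg b <= D)%N by rewrite -mdegD -kE.
by rewrite eP ?eQ //; apply: leq_trans abD; rewrite ?leq_addl ?leq_addr.
Qed.

Lemma eq_upto_prod D (I : Type) (s : seq I) (F G : I -> mpoly m C) :
  (forall i, eq_upto D (F i) (G i)) ->
  eq_upto D (\prod_(i <- s) F i) (\prod_(i <- s) G i).
Proof.
move=> FG; elim: s => [|i s IHs]; first by rewrite !big_nil.
by rewrite !big_cons; apply: eq_uptoM.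
Qed.

Lemma order_geM a b P Q :
  order_ge a P -> order_ge b Q -> order_ge (a + b) (P * Q).
Proof.
move=> oP oQ k kab; rewrite mcoeffM big1 // => -[c d] /= /eqP/(congr1 mdeg) kE.
rewrite mdegD in kE; have [ca|ac] := ltnP (mdeg c) a; first by rewrite oP ?mul0r.
rewrite [X in _ * X]oQ ?mulr0 //.
by rewrite -(ltn_add2l a) (leq_ltn_trans _ kab) // [leqRHS]kE leq_add2r.
Qed.

Lemma order_geX P p : P@_0 = 0 -> order_ge p (P ^+ p).
Proof.
move=> P0; elim: p => [//|p IHp]; rewrite exprS -add1n.
apply: order_geM => // k; rewrite ltnS leqn0 mdeg_eq0 => /eqP-> //.
Qed.

Lemma prod_truncation (I : finType) D (f : I -> 'X_{1..m} -> C) :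
  \prod_(i : I) truncation D (f i) =
  \sum_(K : {ffun I -> 'X_{1..m < D.+1}})
     (\prod_i f i (K i)) *: 'X_[\sum_i K i].
Proof.
rewrite bigA_distr_bigA /=; apply: eq_bigr => K _.
by rewrite scaler_prod mprodXE.
Qed.

End TruncatedPolynomials.

(** * Truncated exponentials *)

Lemma sum_antidiagonals (V : nmodType) D (F : nat -> nat -> V) :
  \sum_(p < D) \sum_(a < p.+1) F (p - a)%N a =
  \sum_(b < D) \sum_(a < D | (b + a < D)%N) F b a.
Proof.
rewrite (exchange_big_dep xpredT) //=.
under [LHS]eq_bigr => p _.
  rewrite (big_ord_widen D (fun a => F (p - a)%N a)) //; over.
(* For fixed [a], substituting [b = p - a] turns [a <= p < D] into [b + a < D]. *)
rewrite (exchange_big_dep xpredT) //=; apply: eq_bigr => a _.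
rewrite -(big_mkord (fun p => a < p.+1)%N (fun p => F (p - a)%N a)).
rewrite -(big_mkord (fun b => b + a < D)%N (fun b => F b a)).
have aD : (a <= D)%N by apply: ltnW.
rewrite (big_cat_nat (n := a)) //= big_nat_cond big1 ?add0r; last first.
  by move=> p /andP[/andP[_ pa]]; rewrite ltnS leqNgt pa.
rewrite -{1}[val a]add0n big_addn [RHS](big_cat_nat (n := (D - a)%N)) ?leq_subr //=.
rewrite [X in _ = _ + X]big_nat_cond [X in _ = _ + X]big1 ?addr0; last first.
  by move=> b /andP[/andP[Db _]]; rewrite ltnNge addnC -leq_subLR Db.
rewrite big_nat_cond [RHS]big_nat_cond; apply: eq_big => [b|b _]; last by rewrite addnK.
by rewrite ltnS leq_addl andbT ltn_subRL addnC; case: ltnP.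
Qed.

Section TruncatedExponential.
Variables (m : nat) (R : numFieldType) (C : comNzRingType) (phi : {rmorphism R -> C}).
Implicit Types P Q : mpoly m C.

(* [phi] provides the inverses of factorials in a ring [C] that need not be an
   [R]-algebra structurally. *)
Definition invfact (p : nat) : C := phi (p`!%:R^-1).

Definition texp D P : mpoly m C := \sum_(p < D.+1) invfact p *: P ^+ p.

Lemma invfact0 : invfact 0 = 1.
Proof. by rewrite /invfact invr1 rmorph1. Qed.

Lemma invfact_bin p a : (a <= p)%N ->
  invfact p *+ 'C(p, a) = invfact (p - a) * invfact a.
Proof.
move=> ap; rewrite /invfact -rmorphMn -rmorphM; congr (phi _).
have nz q : (q`!%:R : R) != 0 by rewrite pnatr_eq0 -lt0n fact_gt0.
apply/eqP; rewrite -mulr_natl -invfM -[eqbRHS]mul1r eqr_div ?mulf_neq0 // mul1r -!natrM.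
by rewrite -(bin_fact ap) [(a`! * _)%N]mulnC.
Qed.

Lemma texp0 D : texp D 0 = 1.
Proof.
rewrite /texp big_ord_recl expr0 invfact0 scale1r big1 ?addr0 // => p _.
by rewrite expr0n scaler0.
Qed.

(** By the binomial theorem the left side collects the terms with [b + a <= D]. The product has
    further terms with [b + a > D], but these have order above [D] because [P] and [Q] have no
    constant term. *)
Lemma texpD D P Q : P@_0 = 0 -> Q@_0 = 0 ->
  eq_upto D (texp D (P + Q)) (texp D P * texp D Q).
Proof.
move=> P0 Q0 k kD.
pose F b a := (invfact b *: P ^+ b) * (invfact a *: Q ^+ a).
have -> : texp D (P + Q) = \sum_(p < D.+1) \sum_(a < p.+1) F (p - a)%N a.
  apply: eq_bigr => p _; rewrite exprDn scaler_sumr; apply: eq_bigr => a _.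
  rewrite /F -!mul_mpolyC mulrACA -mpolyCM -invfact_bin -1?ltnS //.
  by rewrite mul_mpolyC mul_mpolyC -scalerMnl scalerMnr.
rewrite sum_antidiagonals /texp big_distrl !raddf_sum /=; apply: eq_bigr => b _.
rewrite big_distrr !raddf_sum /= [RHS](bigID (fun a : 'I_D.+1 => b + a < D.+1)%N) /=.
rewrite [X in _ = _ + X]big1 ?addr0 // => a; rewrite -leqNgt => Dba.
rewrite -!mul_mpolyC mulrACA -mpolyCM mcoeffCM.
by rewrite (order_geM (order_geX P0) (order_geX Q0)) ?mulr0 // (leq_ltn_trans kD).
Qed.

Lemma texp_sum D (I : Type) (s : seq I) (F : I -> mpoly m C) :
  (forall i, (F i)@_0 = 0) ->
  eq_upto D (texp D (\sum_(i <- s) F i)) (\prod_(i <- s) texp D (F i)).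
Proof.
move=> F0; elim: s => [|i s IHs]; first by rewrite !big_nil texp0.
rewrite !big_cons => k kD.
rewrite texpD //; last by rewrite raddf_sum big1 => [|j _]; [|exact: F0].
by apply: (eq_uptoM _ IHs) kD => l _.
Qed.

(** The exponential splits into one factor per monomial; expanding the product, [r i] is the power
    chosen in factor [i]. The condition on [z] excludes constant terms. *)
Lemma mcoeff_texp_monomials D (I : finType) (z : I -> C) (w : I -> 'X_{1..m}) k :
  (mdeg k <= D)%N -> (forall i, w i = 0%MM -> z i = 0) ->
  (texp D (\sum_i z i *: 'X_[w i]))@_k =
  \sum_(r : {ffun I -> 'I_D.+1} | (\sum_i w i *+ r i)%MM == k)
     \prod_i (invfact (r i) * z i ^+ r i).
Proof.
move=> kD z0; rewrite texp_sum // => [|i]; last first.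
  rewrite mcoeffZ mcoeffX; case: eqP => [/z0 ->|_]; first by rewrite mul0r.
  by rewrite mulr0.
rewrite /texp bigA_distr_bigA /= raddf_sum /= [RHS]big_mkcond.
apply: eq_bigr => r _.
rewrite (eq_bigr (fun i => (invfact (r i) * z i ^+ r i) *: 'X_[w i *+ r i])).
  rewrite scaler_prod mprodXE mcoeffZ mcoeffX; case: eqP => _; by rewrite (mulr0, mulr1).
by move=> i _; rewrite exprZn scalerA mpolyXn.
Qed.

End TruncatedExponential.

(** * Partitions as multiplicity functions on columns *)

Section PartitionsByMultiplicity.
Variable m : nat.
Implicit Types (k : 'X_{1..m}) (s : seq 'X_{1..m}).

Lemma mlex_total : total (@mlex m).
Proof. by move=> c d; exact: le_total. Qed.

Lemma mlex_trans : transitive (@mlex m).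
Proof. by move=> d c e; exact: le_trans. Qed.

Lemma mlex_anti : antisymmetric (@mlex m).
Proof. by move=> c d /le_anti cd; apply/val_inj/val_inj. Qed.

Lemma is_mpartE k s :
  is_mpart k s = [&& sorted (@mlex m) s, 0%MM \notin s & (\sum_(c <- s) c)%MM == k].
Proof.
rewrite /is_mpart; do 2!congr (_ && _); apply/forallP/eqP => [ks|<- r].
  by apply/mnmP => r; rewrite mnm_sumE; apply/eqP.
by rewrite mnm_sumE.
Qed.

Lemma sum_mpart_seq (V : nmodType) k (F : seq 'X_{1..m} -> V) L :
  uniq L -> L =i is_mpart k -> sum_mpart k F = \sum_(s <- L) F s.
Proof.
move=> uL LE; have sL s : s \in L -> (size s < (mdeg k).+1)%N.
  by rewrite LE ltnS => /mpart_bound[].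
transitivity (\sum_(l < (mdeg k).+1) \sum_(s <- L | size s == l) F s).
  apply: eq_bigr => l _.
  rewrite -[LHS]big_filter -[RHS]big_filter -(big_map (fun t : l.-tuple _ => map val t) xpredT).
  apply/perm_big/uniq_perm; last move=> s.
  - rewrite map_inj_uniq ?filter_uniq ?index_enum_uniq // => t u.
    by move=> /(inj_map val_inj)/val_inj.
  - exact: filter_uniq.
  rewrite mem_filter LE; apply/mapP/andP => [[t]|[/eqP sl sk]].
    by rewrite mem_filter => /andP[tk _] ->; rewrite size_map size_tuple.
  have [_ /(_ _ _) dk] := mpart_bound sk.
  (* All columns of a partition of [k] have degree at most [|k|], so [insub] drops none of them. *)
  have st : map val (pmap insub s : seq 'X_{1..m < (mdeg k).+1}) = s.
    rewrite (pmap_filter (insubK _)); apply/all_filterP/allP => c cs.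
    by rewrite isSome_insub ltnS dk.
  have lt : size (pmap insub s : seq 'X_{1..m < (mdeg k).+1}) == l.
    by rewrite -(size_map val) st sl.
  by exists (Tuple lt); rewrite ?mem_filter /= st ?mem_index_enum ?andbT.
rewrite (exchange_big_dep xpredT) //= big_seq [RHS]big_seq; apply: eq_bigr => s /sL ls.
by rewrite (big_pred1 (Ordinal ls)).
Qed.

Section Multiplicities.
Variable D : nat.
Local Notation mult := {ffun 'X_{1..m < D.+1} -> 'I_D.+1}.
Implicit Type r : mult.

(** Sorting selects the lexicographic arrangement of the multiset [r]. The zero column may occur, so
    this need not be a partition. *)
Definition mpart_of_mult r : seq 'X_{1..m} :=
  sort (@mlex m) (flatten [seq nseq (r c) (bmnm c) | c <- enum {: 'X_{1..m < D.+1}}]).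

Lemma big_mpart_of_mult (V : nmodType) (F : 'X_{1..m} -> V) r :
  \sum_(c <- mpart_of_mult r) F c = \sum_c F (bmnm c) *+ r c.
Proof.
rewrite (perm_big _ (permEl (perm_sort _ _))) /= big_flatten big_map big_enum.
by apply: eq_bigr => c _; rewrite big_nseq iter_addr_0.
Qed.

Lemma count_mpart_of_mult r c : count_mem (bmnm c) (mpart_of_mult r) = r c.
Proof.
rewrite -sum1_count big_mkcond big_mpart_of_mult (bigD1 c) //= eqxx big1.
  by rewrite addr0 natn.
move=> d dc; case: eqP => [/val_inj dc'|_]; last exact: mul0rn.
by rewrite dc' eqxx in dc.
Qed.

Lemma mem_mpart_of_mult r c : (bmnm c \in mpart_of_mult r) = (0 < r c)%N.
Proof. by rewrite -has_pred1 has_count count_mpart_of_mult. Qed.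

Lemma mpart_of_mult_bound r c : c \in mpart_of_mult r -> (mdeg c < D.+1)%N.
Proof.
rewrite mem_sort => /flattenP[_ /mapP[d _ ->]]; rewrite mem_nseq => /andP[_ /eqP->].
exact: bmdeg.
Qed.

Lemma size_mpart_of_mult r : size (mpart_of_mult r) = (\sum_c r c)%N.
Proof.
by rewrite -sum1_size big_mpart_of_mult; apply: eq_bigr => c _; rewrite natn.
Qed.

Lemma mpart_of_mult_inj : injective mpart_of_mult.
Proof.
by move=> r r' rr; apply/ffunP => c; apply/val_inj; rewrite /= -!count_mpart_of_mult rr.
Qed.

(** Degrees and multiplicities of columns are bounded by [|k|], hence by [D], and two sorted
    sequences with the same multiplicities coincide. *)
Lemma mpart_of_mult_surj k s : (mdeg k <= D)%N -> is_mpart k s ->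
  exists r, s = mpart_of_mult r.
Proof.
move=> kD sk; have [ssz sdeg] := mpart_bound sk.
have cD c : (count_mem c s < D.+1)%N.
  by rewrite ltnS (leq_trans (count_size _ _)) ?(leq_trans ssz).
exists [ffun c => Ordinal (cD (bmnm c))].
have [ss _ _] := and3P sk.
apply: (sorted_eq mlex_trans mlex_anti ss); first exact: sort_sorted mlex_total _.
apply/allP => c; rewrite mem_cat => /orP[cs|/mpart_of_mult_bound cD'].
  have cD' : (mdeg c < D.+1)%N by rewrite ltnS (leq_trans (sdeg _ cs)).
  by rewrite /= (count_mpart_of_mult _ (BMultinom cD')) ffunE.
by rewrite /= (count_mpart_of_mult _ (BMultinom cD')) ffunE.
Qed.

Lemma sum_mpart_mult (V : nmodType) k (F : seq 'X_{1..m} -> V) : (mdeg k <= D)%N ->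
  sum_mpart k F = \sum_(r : mult | is_mpart k (mpart_of_mult r)) F (mpart_of_mult r).
Proof.
move=> kD.
rewrite (sum_mpart_seq _ (L := [seq mpart_of_mult r | r <- enum {: mult} & is_mpart k (mpart_of_mult r)])).
- by rewrite big_map big_filter big_enum_cond.
- by rewrite (map_inj_uniq (@mpart_of_mult_inj)) filter_uniq // enum_uniq.
move=> s; apply/mapP/idP => [[r]|sk].
  by rewrite mem_filter => /andP[rk _] ->.
have [r sr] := mpart_of_mult_surj kD sk.
by exists r; rewrite // mem_filter mem_enum -sr andbT.
Qed.

Lemma is_mpart_of_mult k r : is_mpart k (mpart_of_mult r) =
  (0%MM \notin mpart_of_mult r) && ((\sum_c bmnm c *+ r c)%MM == k).
Proof.
rewrite is_mpartE (sort_sorted mlex_total) /=; congr (_ && (_ == _)).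
apply/mnmP => t; rewrite !mnm_sumE big_mpart_of_mult; apply: eq_bigr => c _.
by rewrite mulmnE -mulr_natr natn.
Qed.

(** Columns of multiplicity 0 contribute only [idx], so the product over distinct columns extends to
    all bounded ones. *)
Lemma big_undup_mpart_of_mult (T : Type) (idx : T) (op : Monoid.com_law idx)
    (G : 'X_{1..m} -> nat -> T) r :
  (forall c, G c 0%N = idx) ->
  \big[op/idx]_(c <- undup (mpart_of_mult r)) G c (count_mem c (mpart_of_mult r)) =
  \big[op/idx]_c G (bmnm c) (r c).
Proof.
move=> G0; rewrite [RHS](bigID (fun c => bmnm c \in mpart_of_mult r)) /=.
rewrite [X in op _ X]big1 ?Monoid.mulm1 => [|c]; last first.
  by rewrite mem_mpart_of_mult lt0n negbK => /eqP->.
under [RHS]eq_bigr => c _ do rewrite -count_mpart_of_mult.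
rewrite -[RHS]big_filter -(big_map (@bmnm _ _) xpredT (fun c => G c (count_mem c (mpart_of_mult r)))).
apply/perm_big/uniq_perm; first exact: undup_uniq.
  by rewrite map_inj_uniq ?filter_uniq ?index_enum_uniq //; exact: val_inj.
move=> c; rewrite mem_undup; apply/idP/mapP => [cs|[d]]; last first.
  by rewrite mem_filter => /andP[ds _] ->.
by exists (BMultinom (mpart_of_mult_bound cs)); rewrite ?mem_filter /= ?cs ?mem_index_enum.
Qed.

End Multiplicities.
End PartitionsByMultiplicity.

(** * Multinomial expansion of powers of sums of tuples *)

Lemma mcoeff_prod_truncation (m : nat) (C : comNzRingType) (I : finType) D
    (f : I -> 'X_{1..m} -> C) i :
  (\prod_j truncation D (f j))@_i =
  \sum_(K : {ffun I -> 'X_{1..m < D.+1}} | (\sum_j bmnm (K j))%MM == i)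
     \prod_j f j (K j).
Proof.
rewrite prod_truncation raddf_sum /= [RHS]big_mkcond; apply: eq_bigr => K _.
by rewrite mcoeffZ mcoeffX; case: eqP => _; rewrite (mulr0, mulr1).
Qed.

Lemma mfact_neq0 (R : numFieldType) m (k : 'X_{1..m}) : ((mfact k)%:R : R) != 0.
Proof. by rewrite pnatr_eq0 -lt0n prodn_gt0 // => r; exact: fact_gt0. Qed.

Section PowersOfSums.
Variables (m : nat) (R : numFieldType) (C : comNzRingType) (phi : {rmorphism R -> C}).

Lemma mcoeff_texp_linear D (z : 'I_m -> C) k : (mdeg k <= D)%N ->
  (texp phi D (\sum_r z r *: 'X_r))@_k =
  phi (mfact k)%:R^-1 * \prod_r z r ^+ k r.
Proof.
move=> kD; rewrite mcoeff_texp_monomials // => [|r /(congr1 mdeg)]; last first.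
  by rewrite mdeg1 mdeg0.
have kr (r : 'I_m) : (k r < D.+1)%N.
  by rewrite ltnS (leq_trans _ kD) // mdegE (bigD1 r) //= leq_addr.
(* The weights are the unit vectors, so [k] itself is the only admissible multiplicity function. *)
rewrite (big_pred1 [ffun r => Ordinal (kr r)]) => [|f].
  rewrite big_split /=; congr (_ * _); last first.
    by apply: eq_bigr => r _; rewrite ffunE.
  rewrite /mfact natr_prod -prodfV rmorph_prod; apply: eq_bigr => r _.
  by rewrite ffunE.
have fE : (\sum_r U_(r) *+ f r)%MM = [multinom (f r : nat) | r < m].
  apply/mnmP => r; rewrite mnm_sumE mnmE (bigD1 r) //= big1 => [|q qr].
    by rewrite mulmnE mnm1E eqxx mul1n addn0.
  by rewrite mulmnE mnm1E (negbTE qr) mul0n.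
rewrite fE; apply/eqP/eqP => [/mnmP fk|->].
  by apply/ffunP => r; apply/val_inj; rewrite ffunE /= -fk mnmE.
by apply/mnmP => r; rewrite mnmE ffunE.
Qed.

Lemma tuple_pow_sum n (y : 'I_n -> m.-tuple C) (i : 'X_{1..m}) :
  tuple_pow [tuple \sum_j tnth (y j) r | r < m] i =
  phi (mfact i)%:R *
  \sum_(K : {ffun 'I_n -> 'X_{1..m < (mdeg i).+1}} | (\sum_j bmnm (K j))%MM == i)
     \prod_j (phi (mfact (K j))%:R^-1 * tuple_pow (y j) (K j)).
Proof.
set D := mdeg i; pose z r := \sum_j tnth (y j) r.
have -> : tuple_pow [tuple z r | r < m] i =
    phi (mfact i)%:R * (texp phi D (\sum_r z r *: 'X_r))@_i.
  rewrite mcoeff_texp_linear // mulrA -rmorphM divff ?mfact_neq0 // rmorph1 mul1r.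
  by apply: eq_bigr => r _; rewrite tnth_mktuple.
congr (_ * _).
pose f j k := phi (mfact k)%:R^-1 * tuple_pow (y j) k.
rewrite -(mcoeff_prod_truncation D f).
(* Regrouping the linear form by tuples lets its exponential factor over [j]. *)
have -> : \sum_r z r *: 'X_r = \sum_j \sum_r tnth (y j) r *: 'X_r :> mpoly m C.
  by rewrite exchange_big; apply: eq_bigr => r _; rewrite scaler_suml.
rewrite texp_sum // => [|j]; last first.
  rewrite raddf_sum big1 // => r _.
  by rewrite /= mcoeffZ mcoeffX -mdeg_eq0 mdeg1 mulr0.
apply: (eq_upto_prod (D := D)) => // j k kD.
by rewrite mcoeff_texp_linear // mcoeff_truncation.
Qed.

End PowersOfSums.

(** * Exponentials of power series through truncation *)

Section FpsExp.
Variables (R : numFieldType) (m : nat) (C : comAlgType R).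

Lemma fps_pow_truncation D (g : fps m C) p k : (mdeg k <= D)%N ->
  fps_pow g p k = ((truncation D g) ^+ p)@_k.
Proof.
elim: p k => [|p IHp] k kD; first by rewrite expr0 mcoeff1.
(* Both convolutions run over the same pairs of exponents. *)
rewrite exprS mcoeffM /= /fps_mul; apply: eq_bigr => -[a b] /= /eqP/(congr1 mdeg).
rewrite mdegD => kE; rewrite IHp ?mcoeff_truncation //;
  by rewrite (leq_trans _ kD) // [leqRHS]kE (leq_addr, leq_addl).
Qed.

Lemma fps_exp_texp (g : fps m C) k :
  fps_exp g k = (texp (in_alg C) (mdeg k) (truncation (mdeg k) g))@_k.
Proof.
rewrite /fps_exp /texp raddf_sum; apply: eq_bigr => p _.
by rewrite /= mcoeffZ (fps_pow_truncation _ _ (leqnn _)) mulr_algl.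
Qed.

End FpsExp.

(** * Bell polynomials and moments of the auxiliary tuples *)

Section BellPolynomials.
Variables (R : numFieldType) (n m : nat) (A : choiceType).
Variable E : {scalar upoly R n A}.
Local Notation Rx := {mpoly R[n]}.

Lemma genfunB1 (nu : m.-tuple (upoly R n A)) k :
  genfun E nu k - fps_one Rx k =
  if k == 0%MM then 0 else ((mfact k)%:R^-1 : R) *: E (tuple_pow nu k).
Proof. by rewrite /genfun /fps_one; case: eqP => _; rewrite ?subrr ?subr0. Qed.

(** Both sides become sums over multiplicity functions and agree term by term. *)
Lemma aux_moment_texp D (j : 'I_n) (nu : m.-tuple (upoly R n A)) k :
  (mdeg k <= D)%N ->
  aux_moment E j nu k = ((mfact k)%:R : R) *:
    (texp (in_alg Rx) D
      (truncation D (fun c => 'X_j * (genfun E nu c - fps_one Rx c))))@_k.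
Proof.
move=> kD; rewrite /aux_moment (sum_mpart_mult _ kD).
rewrite mcoeff_texp_monomials // => [|c c0]; last by rewrite genfunB1 c0 eqxx mulr0.
rewrite scaler_sumr big_mkcond [RHS]big_mkcond; apply: eq_bigr => r _.
rewrite is_mpart_of_mult andbC; case: eqP => //= _.
set s := mpart_of_mult r.
(* If the zero column occurs, there is no partition, and the expansion has a factor 0 to a positive
   power. *)
have [s0|s0] := boolP (0%MM \in s).
  have z0 : (mdeg (0%MM : 'X_{1..m}) < D.+1)%N by rewrite mdeg0.
  rewrite (bigD1 (BMultinom z0)) //= genfunB1 eqxx mulr0 expr0n.
  have := s0; rewrite (mem_mpart_of_mult r (BMultinom z0)) lt0n => /negbTE->.
  by rewrite mulr0 mul0r scaler0.
have -> : (mpart_mult s * mpart_fact s)%:R =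
    \prod_(c : 'X_{1..m < D.+1}) ((r c)`! * mfact c ^ r c)%:R :> R.
  rewrite /mpart_mult /mpart_fact.
  rewrite (big_undup_mpart_of_mult _ (G := fun c k => k`!)) //.
  rewrite (big_undup_mpart_of_mult _ (G := fun c k => mfact c ^ k)%N) //.
  by rewrite -big_split natr_prod.
rewrite (big_undup_mpart_of_mult _ (G := fun c k => E (tuple_pow nu c) ^+ k)) //.
rewrite size_mpart_of_mult -scalerA; congr (_ *: _).
(* The length is the sum of the multiplicities, so the power of ['X_j] distributes over the
   columns. *)
rewrite -prodrXr -big_split -prodfV -scaler_prod /=; apply: eq_bigr => c _.
rewrite mulr_algl genfunB1; case: eqP => [c0|_].
  have -> : val (r c) = 0%N.
    apply/eqP; rewrite -leqn0 leqNgt -mem_mpart_of_mult c0; exact: s0.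
  by rewrite !expr0 mulr1 muln1 fact0 invr1.
by rewrite exprMn exprZn -scalerAr scalerA natrM natrX invfM exprVn.
Qed.

(** The exponential factors over [j], and factor [j] has the moments divided by factorials as
    coefficients. *)
Lemma bell_poly_moments (nu : 'I_n -> m.-tuple (upoly R n A)) i :
  bell_poly E nu i = ((mfact i)%:R : R) *:
  \sum_(K : {ffun 'I_n -> 'X_{1..m < (mdeg i).+1}} | (\sum_j bmnm (K j))%MM == i)
     \prod_j (((mfact (K j))%:R^-1 : R) *: aux_moment E j (nu j) (K j)).
Proof.
set D := mdeg i; pose f j k := ((mfact k)%:R^-1 : R) *: aux_moment E j (nu j) k.
rewrite -(mcoeff_prod_truncation D f) /bell_poly mulr_natl -scaler_nat; congr (_ *: _).
pose g j c := 'X_j * (genfun E (nu j) c - fps_one Rx c).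
rewrite fps_exp_texp -/D.
have -> : truncation D (fun k => \sum_j g j k) = \sum_j truncation D (g j).
  by rewrite exchange_big; apply: eq_bigr => k _; rewrite scaler_suml.
rewrite texp_sum // => [|j]; last first.
  by rewrite mcoeff_truncation ?mdeg0 // /g genfunB1 eqxx mulr0.
apply: (eq_upto_prod (D := D)) => // j k kD.
rewrite mcoeff_truncation // /f (aux_moment_texp _ _ kD) scalerA mulVf ?scale1r //.
exact: mfact_neq0.
Qed.

Lemma aux_sum_moments (hE : umbral_evaluation E)
    (nu : 'I_n -> m.-tuple (upoly R n A)) i :
  aux_eval E nu (tuple_pow (aux_sum R n m A) i) = ((mfact i)%:R : R) *:
  \sum_(K : {ffun 'I_n -> 'X_{1..m < (mdeg i).+1}} | (\sum_j bmnm (K j))%MM == i)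
     \prod_j (((mfact (K j))%:R^-1 : R) *: aux_moment E j (nu j) (K j)).
Proof.
pose Y := upoly R n (aux_alphabet n m A).
(* Scalars of [R] enter [Y] through [Rx], over which [aux_eval] is linear. *)
pose phi : {rmorphism R -> Y} := in_alg Y \o in_alg Rx.
rewrite /aux_sum (tuple_pow_sum phi) mulr_algl linearZ /= mulr_algl; congr (_ *: _).
rewrite raddf_sum; apply: eq_bigr => K _.
rewrite big_split -(rmorph_prod phi) /= mulr_algl linearZ /= mulr_algl scaler_prod.
congr (_ *: _).
(* No umbra of [A] occurs here, hence the empty list. *)
have := aux_evalE nu (fun=> 0%N) (fun j => bmnm (K j)) hE (isT : uniq [::]).
by rewrite !big_nil !mul1r umbral_eval1 // mul1r.
Qed.

End BellPolynomials.

Theorem corollary3p1 (R : numFieldType) (n m : nat) (A : choiceType)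
    (E : {scalar upoly R n A}) (hE : umbral_evaluation E)
    (nu : 'I_n -> m.-tuple (upoly R n A))
    (hnu : forall (j : 'I_n) (r : 'I_m), umbral_monomial (tnth (nu j) r))
    (i : 'X_{1..m}) :
  umbral_equiv (aux_eval E nu)
    (mkmalgU mone (bell_poly E nu i)) (tuple_pow (aux_sum R n m A) i)
  /\ bell_poly E nu i = aux_eval E nu (tuple_pow (aux_sum R n m A) i).
Proof.
have eq_moment : bell_poly E nu i = aux_eval E nu (tuple_pow (aux_sum R n m A) i).
  by rewrite aux_sum_moments // bell_poly_moments.
(* It remains that [aux_eval] fixes constants: at the trivial monomial all exponents are 0, and all
   zeroth moments are 1. *)
split=> //; rewrite /umbral_equiv -eq_moment /aux_eval monalg.mmapU /=.
rewrite /aux_eval_monom big1 ?mul1r => [|[a _|//]]; last first.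
  by rewrite cm1 expr0 umbral_eval1.
rewrite big1 ?mulr1 // => j _; rewrite -[RHS](aux_moment0 E j (nu j)).
by congr aux_moment; apply/mnmP => r; rewrite mnmE mnm0E cm1.
Qed.
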